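(* Let $X$ be a set and let $\mathbf{S}\le(\mathrm{End}(X),\circ)$ be a transformation semigroup over $X$. Then the function $k\colon \mathrm{Surj}(\epsilon_{\mathbf{S}},\circ_{\mathbf{S}})\to\mathcal{S}(\mathbf{S})$ sending $\phi$ to the set $X$ equipped with the multiplication $x\cdot y=\phi(x)(y)$ is (well defined and) a bijection.
   Context: For a set $X$, $\mathrm{End}(X)$ is the set of all functions $X\to X$; a transformation semigroup over $X$ is a subsemigroup $\mathbf{S}$ (with underlying set $S$) of $(\mathrm{End}(X),\circ)$. There are two canonical $\mathbf{S}$-actions: $\epsilon_{\mathbf{S}}\colon S\times X\to X$, $(f,x)\mapsto f(x)$, and $\circ_{\mathbf{S}}\colon S\times S\to S$, $(f,g)\mapsto f\circ g$. A morphism of actions $\epsilon_{\mathbf{S}}\to\circ_{\mathbf{S}}$ is a function $\phi\colon X\to S$ with $\phi(f(x))=f\circ\phi(x)$ for all $f\in S$, $x\in X$; $\mathrm{Surj}(\epsilon_{\mathbf{S}},\circ_{\mathbf{S}})$ is the set of surjective such morphisms. For a semigroup $\mathbf{X}=(X,\cdot)$ the representing map is $\phi_{\mathbf{X}}\colon X\to\mathrm{End}(X)$, $\phi_{\mathbf{X}}(x)(y)=x\cdot y$, and its image (a transformation semigroup over $X$) is called the representation of $\mathbf{X}$. $\mathcal{S}(\mathbf{S})$ denotes the set of all semigroups with underlying set $X$ whose representation is $\mathbf{S}$ (the set of unrepresentations of $\mathbf{S}$); no faithfulness is assumed here. *)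

(* Defs.v *)
From mathcomp Require Import all_boot.
From mathcomp Require Import boolp classical_sets functions.

Set Implicit Arguments.
Unset Strict Implicit.
Unset Printing Implicit Defensive.

Local Open Scope classical_set_scope.

(* Semigroups are allowed to be empty: [X] and the carrier are arbitrary.
   Through the coercions, a transformation semigroup [S] is also the type
   [{f : X -> X | f \in S}] of its elements. *)
Record transformation_semigroup (X : Type) := TransformationSemigroup {
  ts_carrier :> set (X -> X);
  ts_comp : forall f g : X -> X,
    ts_carrier f -> ts_carrier g -> ts_carrier (f \o g) }.

Section Actions.
Context (X : Type) (S : transformation_semigroup X).

Definition eval_action (f : S) (x : X) : X := val f x.

Definition comp_action (f g : S) : S :=
  SigSub (mem_set (ts_comp (set_valP f) (set_valP g))).

End Actions.

Definition action_morphism (A X Y : Type) (a : A -> X -> X) (b : A -> Y -> Y)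
    (phi : X -> Y) : Prop :=
  forall s x, phi (a s x) = b s (phi x).

Definition Surj (A X Y : Type) (a : A -> X -> X) (b : A -> Y -> Y) :
    set (X -> Y) :=
  [set phi | action_morphism a b phi /\ set_surj setT setT phi].

(* The multiplication is arbitrary here; it is required to be associative in
   [unrepresentations]. *)
Definition representing_map (X : Type) (mul : X -> X -> X) : X -> (X -> X) :=
  fun x y => mul x y.

Definition representation (X : Type) (mul : X -> X -> X) : set (X -> X) :=
  range (representing_map mul).

(* A semigroup with underlying set [X] is given by its multiplication. *)
Definition unrepresentations (X : Type) (S : transformation_semigroup X) :
    set (X -> X -> X) :=
  [set mul | associative mul /\ representation mul = S].

Definition unrep_mul (X : Type) (S : transformation_semigroup X)
    (phi : X -> S) : X -> X -> X :=
  fun x y => val (phi x) y.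

(* Main.v *)
Require Import Defs.
From mathcomp Require Import all_boot.
From mathcomp Require Import boolp classical_sets functions.

Local Open Scope classical_set_scope.

(** The representing map of [unrep_mul phi] is [phi] followed by the inclusion of [S] into the
    self-maps of [X]. Hence its image is [S] iff [phi] is onto, and associativity is the morphism
    equation at those [f] of the form [phi x], which are all of [S] once [phi] is onto. *)

Lemma unrep_mul_fun (X : Type) (S : transformation_semigroup X) :
  set_fun (Surj (@eval_action X S) (@comp_action X S)) (unrepresentations S)
    (@unrep_mul X S).
Proof.
move=> phi [morph surj]; split.
  (* The morphism equation at [f = phi x] is associativity. *)
  move=> x y z; rewrite /unrep_mul.
  by have := morph (phi x) y; rewrite /eval_action => ->.
apply/seteqP; split=> [_ [x _ <-]|f Sf]; first exact: set_valP (phi x).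
have [x _ phix] := surj (SigSub (mem_set Sf)) I.
by exists x => //; rewrite /representing_map /unrep_mul phix.
Qed.

Lemma unrep_mul_inj (X : Type) (S : transformation_semigroup X) :
  injective (@unrep_mul X S).
Proof.
move=> phi psi eq_mul; apply/funext => x; apply: val_inj.
exact: (congr1 (fun mul => mul x) eq_mul).
Qed.

Lemma unrep_mul_surj (X : Type) (S : transformation_semigroup X) :
  set_surj (Surj (@eval_action X S) (@comp_action X S)) (unrepresentations S)
    (@unrep_mul X S).
Proof.
move=> mul [mulA rep_mul].
have Smul x : ts_carrier S (mul x) by rewrite -rep_mul; exists x.
have mulS (f : S) : exists x, mul x = val f.
  have [x _ mulx] : representation mul (val f) by rewrite rep_mul; apply: set_valP.
  by exists x.
(* The only candidate: the representing map of [mul], corestricted to [S]. *)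
pose phi x : S := SigSub (mem_set (Smul x)).
(* Writing [f] as [mul a] turns the morphism equation into associativity at [a], [x], [y], and makes
   [a] a preimage of [f]. *)
exists phi => //; split=> [f x|f _]; have [a mul_a] := mulS f.
  apply: val_inj; apply/funext => y.
  change (mul (val f x) y = val f (mul x y)).
  by rewrite -mul_a mulA.
by exists a => //; apply: val_inj.
Qed.

(* [set_bij] includes that [unrep_mul] maps the source set into the target
   set, i.e. that the map is well defined. *)
Theorem proposition2p6 (X : Type) (S : transformation_semigroup X) :
  set_bij (Surj (@eval_action X S) (@comp_action X S)) (unrepresentations S)
    (@unrep_mul X S).
Proof.
split; [exact: unrep_mul_fun | | exact: unrep_mul_surj].
by move=> phi psi _ _; apply: unrep_mul_inj.
Qed.
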